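(* Let $H$ be a graph that is a spanning subgraph of a contractibly orderable graph. Then every graph with minimum degree at least $|V(H^+)|-1$ contains an $H^+$-minor such that the branch set of the apex is a singleton.
   Context: All graphs are finite, nonempty and simple. For an edge $e=uv$ of a graph $H$, $H/e$ is the graph obtained by contracting $e$ and deleting resulting loops and parallel edges. $[t]=\{1,\dots,t\}$. $H^+$ is the graph obtained from $H$ by adding a new vertex, called the apex, adjacent to every vertex of $H$. An $F$-minor in a graph $G$ is a family $\mu=\{\mu(v):v\in V(F)\}$ of pairwise disjoint (nonempty) subsets of $V(G)$ such that $G[\mu(v)]$ is connected for every $v\in V(F)$ and, for every edge $xy\in E(F)$, there is an edge of $G$ with one end in $\mu(x)$ and the other in $\mu(y)$; $\mu(v)$ is the branch set of $v$. An ordering of a graph $H$ on $t$ vertices is a sequence $\omega=(\omega_1,\dots,\omega_t)$ listing each vertex of $H$ exactly once; for $S\subseteq[t]$, $\omega_S=\{\omega_s:s\in S\}$. The ordering is recursive if for all $s\in[t-1]$, $\omega_{s+1}$ is adjacent to at most two vertices in $\omega_{[s]}$, and if it is adjacent to exactly two vertices in $\omega_{[s]}$, then these two vertices are adjacent in $H$. A contractible ordering of $H$ is a nonempty set $\Omega$ of recursive orderings of $H$ such that for every $\omega\in\Omega$ and $s\in[t-1]$, if $\omega_{s+1}$ is adjacent to two vertices in $\omega_{[s]}$, say $\omega_i$ and $\omega_j$, then there exists $\omega'\in\Omega$ such that $H[\omega_{[s]}]/\omega_i\omega_j$ is isomorphic to $H[\omega'_{[s-1]}]$. $H$ is contractibly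 orderable if it admits a contractible ordering. *)

(* Defs.v *)
From mathcomp Require Import all_boot.

Set Implicit Arguments.
Unset Strict Implicit.
Unset Printing Implicit Defensive.

(* Emptiness of V is not excluded here; statements assume 0 < #|V|. *)
Record sgraph (V : finType) := SGraph {
  edge :> rel V;
  edge_sym : symmetric edge;
  edge_irrefl : irreflexive edge }.

Definition neighbors (V : finType) (G : sgraph V) (x : V) : {set V} :=
  [set y | G x y].

Definition degree (V : finType) (G : sgraph V) (x : V) : nat :=
  #|neighbors G x|.

Definition connected (V : finType) (G : sgraph V) : Prop :=
  0 < #|V| /\ forall x y : V, connect G x y.

Definition isomorphic (V W : finType) (G : sgraph V) (H : sgraph W) : Prop :=
  exists2 f : V -> W, bijective f & forall x y : V, H (f x) (f y) = G x y.

(* Both graphs live on the same vertex type. *)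
Definition spanning_subgraph (V : finType) (G H : sgraph V) : Prop :=
  forall x y : V, G x y -> H x y.

Section Induced.
Variables (V : finType) (G : sgraph V) (S : {set V}).

Definition induced_edge : rel {x : V | x \in S} :=
  fun x y => G (val x) (val y).

Fact induced_sym : symmetric induced_edge.
Proof. by move=> x y; apply: edge_sym. Qed.

Fact induced_irrefl : irreflexive induced_edge.
Proof. by move=> x; apply: edge_irrefl. Qed.

Definition induced : sgraph {x : V | x \in S} :=
  SGraph induced_sym induced_irrefl.
End Induced.

(* G / uv: the vertices u and v are replaced by the single vertex None. It is
   meant for adjacent u and v, but the construction is total. *)
Section Contraction.
Variables (V : finType) (G : sgraph V) (u v : V).

Definition contract_edge : rel (option {x : V | x \notin [set u; v]}) :=
  fun a b =>
    match a, b with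
    | Some x, Some y => G (val x) (val y)
    | Some x, None => G (val x) u || G (val x) v
    | None, Some y => G (val y) u || G (val y) v
    | None, None => false
    end.

Fact contract_sym : symmetric contract_edge.
Proof. by case=> [x|] [y|] //=; apply: edge_sym. Qed.

Fact contract_irrefl : irreflexive contract_edge.
Proof. by case=> [x|] //=; apply: edge_irrefl. Qed.

Definition contract : sgraph (option {x : V | x \notin [set u; v]}) :=
  SGraph contract_sym contract_irrefl.
End Contraction.

(* H^+, with apex None. *)
Section Cone.
Variables (V : finType) (H : sgraph V).

Definition cone_edge : rel (option V) :=
  fun a b =>
    match a, b with
    | Some x, Some y => H x y
    | None, None => false
    | _, _ => true
    end.

Fact cone_sym : symmetric cone_edge.
Proof. by case=> [x|] [y|] //=; apply: edge_sym. Qed.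

Fact cone_irrefl : irreflexive cone_edge.
Proof. by case=> [x|] //=; apply: edge_irrefl. Qed.

Definition cone : sgraph (option V) := SGraph cone_sym cone_irrefl.
End Cone.

Definition is_minor (V W : finType) (F : sgraph V) (G : sgraph W)
    (mu : V -> {set W}) : Prop :=
  [/\ forall v : V, mu v != set0,
      forall v w : V, v != w -> [disjoint mu v & mu w],
      forall v : V, connected (induced G (mu v)) &
      forall x y : V, F x y ->
        exists a b : W, [/\ a \in mu x, b \in mu y & G a b]].

Section Orderings.
Variables (V : finType) (H : sgraph V).

(* An ordering omega = (omega_1, ..., omega_t) of H is a duplicate-free
   w : #|V|.-tuple V, hence an enumeration of V. Entries are indexed from 0:
   tnth w s is omega_(s+1), and prefix w s is omega_[s]. *)
Definition prefix (w : #|V|.-tuple V) (s : nat) : {set V} :=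
  [set x in take s w].

Definition back_neighbors (w : #|V|.-tuple V) (s : 'I_#|V|) : {set V} :=
  neighbors H (tnth w s) :&: prefix w s.

Definition recursive (w : #|V|.-tuple V) : Prop :=
  forall s : 'I_#|V|, 0 < s ->
    #|back_neighbors w s| <= 2 /\
    (#|back_neighbors w s| = 2 ->
      {in back_neighbors w s &, forall x y : V, x != y -> H x y}).

Definition contractible_ordering (Omega : {set #|V|.-tuple V}) : Prop :=
  [/\ Omega != set0,
      forall w, w \in Omega -> uniq w /\ recursive w &
      forall w, w \in Omega -> forall s : 'I_#|V|, 0 < s ->
        forall x y : {x : V | x \in prefix w s},
          x != y -> H (tnth w s) (val x) -> H (tnth w s) (val y) ->
          exists2 w', w' \in Omega &
            isomorphic (contract (induced H (prefix w s)) x y)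
                       (induced H (prefix w' s.-1))].

Definition contractibly_orderable : Prop :=
  exists Omega : {set #|V|.-tuple V}, contractible_ordering Omega.
End Orderings.

(* Main.v *)
(* Proof idea. Fix a contractible ordering Omega, let t = #|V|, and consider the
   pairs of a model B of H[w_[s]] in G, for some w in Omega and s <= t, and a
   nonempty set C of vertices outside B such that, when every branch set is
   contracted to a vertex, each vertex of C keeps at least t neighbours in C
   and B, and cannot be separated from the s branch sets by fewer than s
   vertices ("linked"). Let m_s be the least possible size of C. Then
   m_(s+1) < m_s < m_(s-1) for 0 < s < t:
   - Some u in C is adjacent to all the branch sets that w_(s+1) has to see: if
     these are the branch sets of w_i and w_j and there is no such u, merging
     the two lowers no degree of C and gives a model for s-1 with the same C.
   - Make {u} the branch set of w_(s+1) and remove u from C. If linkedness fails,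
     s vertices P separate some z in C from the branch sets and u. By Menger's
     theorem P is joined to the s branch sets by disjoint paths, and absorbing
     these paths yields a model for s whose C is the side of z, which does not
     contain u; this contradicts the choice of C.
   For s = t, Menger's theorem gives t disjoint paths from the neighbours of any
   z in C to the t branch sets, so that z can be the apex. *)
Require Import Defs.
From mathcomp Require Import all_boot.
From Stdlib Require Import Classical.

Set Implicit Arguments.
Unset Strict Implicit.
Unset Printing Implicit Defensive.

(* all_boot shadows it with the homonym on sequences. *)
Local Notation prefix := Defs.prefix.

(** * Menger's theorem *)

Lemma connect_ind (T : finType) (e : rel T) (a : T -> Prop) x y :
  (forall u v, a u -> e u v -> a v) -> a x -> connect e x y -> a y.
Proof.
move=> ea ax /connectP [p ep ->] {y}.
by elim: p x ax ep => //= v p IHp x ax /andP [exv /IHp]; apply; apply: ea exv.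
Qed.

Lemma connect_rind (T : finType) (e : rel T) (a : T -> Prop) x y :
  (forall u v, a v -> e u v -> a u) -> a y -> connect e x y -> a x.
Proof.
move=> ea ay /connectP [p ep yE]; rewrite {y}yE in ay.
elim: p x ay ep => //= v p IHp x ay /andP [exv /(IHp _ ay)] av.
exact: ea exv.
Qed.

Definition avoid (T : finType) (e : rel T) (S : {set T}) : rel T :=
  [rel x y | [&& e x y, x \notin S & y \notin S]].

Lemma connect_avoidS (T : finType) (e e' : rel T) (S S' : {set T}) x y :
  subrel e e' -> S' \subset S ->
  connect (avoid e S) x y -> connect (avoid e' S') x y.
Proof.
move=> see' sS; apply: connect_sub => u v /and3P [euv uS vS].
by apply/connect1/and3P; split; [exact: see' | exact: contra (subsetP sS u) uS
  | exact: contra (subsetP sS v) vS].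
Qed.

Lemma connect_avoid_end (T : finType) (e : rel T) (S : {set T}) x y :
  x \notin S -> connect (avoid e S) x y -> y \notin S.
Proof. by apply: (connect_ind (a := fun v => v \notin S)) => u v _ /and3P []. Qed.

Lemma path_avoid (T : finType) (e : rel T) (S : {set T}) x p :
  path e x p -> {in x :: p, forall v, v \notin S} -> path (avoid e S) x p.
Proof.
elim: p x => //= y p IHp x /andP [exy ep] xpS.
have xS : x \notin S by apply: xpS; rewrite mem_head.
have yS : y \notin S by apply: xpS; rewrite !inE eqxx orbT.
rewrite /avoid /= exy xS yS /=; apply: IHp => // v vp.
by apply: xpS; rewrite inE vp orbT.
Qed.

(** [connect] is reflexive, so the ends have to be required outside [S]; a separator then contains
    [A :&: B]. *)
Definition separates (T : finType) (e : rel T) (A B S : {set T}) : Prop :=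
  forall a b, a \in A -> b \in B -> a \notin S -> b \notin S ->
  ~~ connect (avoid e S) a b.

(** A path is stored as its first vertex and the list of the others, so it is never empty. Inner
    vertices may lie in [A] or [B]. *)
Definition linkage (T : finType) (e : rel T) (A B : {set T}) k
    (f : 'I_k -> T * seq T) : Prop :=
  (forall i, [/\ path e (f i).1 (f i).2, (f i).1 \in A,
              last (f i).1 (f i).2 \in B & uniq ((f i).1 :: (f i).2)]) /\
  (forall i j v, v \in (f i).1 :: (f i).2 -> v \in (f j).1 :: (f j).2 -> i = j).

(** Cutting the cycles out of a walk adds no vertex, so disjointness survives. *)
Lemma shorten_linkage (T : finType) (e : rel T) (A B : {set T}) k
    (f : 'I_k -> T * seq T) :
  (forall i, [/\ path e (f i).1 (f i).2, (f i).1 \in A &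
              last (f i).1 (f i).2 \in B]) ->
  (forall i j v, v \in (f i).1 :: (f i).2 -> v \in (f j).1 :: (f j).2 -> i = j) ->
  exists f', linkage e A B (k := k) f'.
Proof.
move=> fP fD.
have /fin_all_exists [g gP] : forall i, exists p,
    [/\ path e (f i).1 p, last (f i).1 p \in B, uniq ((f i).1 :: p) &
     {subset (f i).1 :: p <= (f i).1 :: (f i).2}].
  move=> i; have [ep _] := fP i; case/shortenP: ep => p ep up sp pB.
  exists p; split=> // v; rewrite !inE => /orP [-> // | /sp ->].
  by rewrite orbT.
exists (fun i => ((f i).1, g i)); split=> [i | i j v /=].
  by have [? ? ? _] := gP i; have [_ ? _] := fP i; split.
have [_ _ _ si] := gP i; have [_ _ _ sj] := gP j.
by move=> /si vi /sj; apply: fD.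
Qed.

Lemma inj_ord_onto (T : finType) k (X : {set T}) (h : 'I_k -> T) :
  injective h -> (forall i, h i \in X) -> #|X| = k ->
  {in X, forall x, exists i, h i = x}.
Proof.
move=> hI hX Xk x xX.
have /eqP E : h @: setT == X.
  rewrite eqEcard card_imset // cardsT card_ord Xk leqnn andbT.
  by apply/subsetP => _ /imsetP [i _ ->].
by move: xX; rewrite -E => /imsetP [i _ ->]; exists i.
Qed.

(** * Gluing two linkages across a deleted arc *)

Section ArcDeletion.
Variables (T : finType) (e : rel T) (x y : T).

Let del : rel T := [rel u v | e u v && ((u, v) != (x, y))].

Let del_sub : subrel del e.
Proof. by move=> u v /andP []. Qed.

Variables (A B S : {set T}).
Hypothesis sepS : separates del A B S.

Lemma separates_tail : separates e A B (x |: S).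
Proof.
move=> a b aA bB; rewrite !inE !negb_or => /andP [ax aS] /andP [bx bS].
apply: contra (sepS aA bB aS bS); apply: connect_sub => u v.
rewrite /avoid /= !inE !negb_or => /and3P [euv /andP [ux uS] /andP [vx vS]].
by apply: connect1; rewrite /= /del /= euv uS vS xpair_eqE negb_and ux.
Qed.

Lemma separates_head : separates e A B (y |: S).
Proof.
move=> a b aA bB; rewrite !inE !negb_or => /andP [ax aS] /andP [bx bS].
apply: contra (sepS aA bB aS bS); apply: connect_sub => u v.
rewrite /avoid /= !inE !negb_or => /and3P [euv /andP [ux uS] /andP [vx vS]].
by apply: connect1; rewrite /= /del /= euv uS vS xpair_eqE negb_and vx orbT.
Qed.

(** Follow an [e]-walk from [A] to [B] that avoids [Q]. While it uses arcs of [del] it cannot meet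
    [x |: S], which [Q] separates from [A]; so it never takes the arc out of [x], and is a
    [del]-walk avoiding [S]. *)
Lemma separates_from Q : separates del A (x |: S) Q -> separates e A B Q.
Proof.
move=> sepQ a b aA bB aQ bQ; apply/negP => cab.
pose reach v := connect (avoid del (Q :|: S)) a v.
have out v : v \notin Q -> connect (avoid del Q) a v -> v \notin x |: S.
  by move=> vQ cv; apply/negP => vX; case/negP: (sepQ _ _ aA vX aQ vQ).
have aS : a \notin S.
  by have := out a aQ (connect0 _ _); rewrite !inE negb_or => /andP [].
have {cab} rb : reach b /\ b \notin S.
  move: cab; apply: (connect_ind (a := fun v => reach v /\ v \notin S)) => [u v|].
    move=> [ru uS] /and3P [euv uQ vQ].
    have ruQ : connect (avoid del Q) a u.
      by apply: connect_avoidS ru => //; apply: subsetUl.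
    have ux : u != x by have := out u uQ ruQ; rewrite !inE negb_or => /andP [].
    have duv : del u v by rewrite /del /= euv xpair_eqE negb_and ux.
    have vS : v \notin S.
      suff /(out v vQ): connect (avoid del Q) a v.
        by rewrite !inE negb_or => /andP [].
      by apply: connect_trans ruQ (connect1 _); rewrite /avoid /= duv uQ vQ.
    split=> //; apply: connect_trans ru (connect1 _).
    by rewrite /avoid /= duv !inE !negb_or uQ vQ uS vS.
  by split; first exact: connect0.
case/negP: (sepS aA bB aS rb.2); apply: connect_avoidS rb.1 => //.
exact: subsetUr.
Qed.

(** Mirror image of [separates_from]: the walk is followed backwards from [B] and never enters
    [y]. *)
Lemma separates_to Q : separates del (y |: S) B Q -> separates e A B Q.
Proof.
move=> sepQ a b aA bB aQ bQ; apply/negP => cab.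
pose reach v := connect (avoid del (Q :|: S)) v b.
have out v : v \notin Q -> connect (avoid del Q) v b -> v \notin y |: S.
  by move=> vQ cv; apply/negP => vX; case/negP: (sepQ _ _ vX bB vQ bQ).
have bS : b \notin S.
  by have := out b bQ (connect0 _ _); rewrite !inE negb_or => /andP [].
have {cab} ra : reach a /\ a \notin S.
  move: cab; apply: (connect_rind (a := fun v => reach v /\ v \notin S)) => [u v|].
    move=> [rv vS] /and3P [euv uQ vQ].
    have rvQ : connect (avoid del Q) v b.
      by apply: connect_avoidS rv => //; apply: subsetUl.
    have vy : v != y by have := out v vQ rvQ; rewrite !inE negb_or => /andP [].
    have duv : del u v by rewrite /del /= euv xpair_eqE negb_and vy orbT.
    have uS : u \notin S.
      suff /(out u uQ): connect (avoid del Q) u b.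
        by rewrite !inE negb_or => /andP [].
      by apply: connect_trans (connect1 _) rvQ; rewrite /avoid /= duv uQ vQ.
    split=> //; apply: connect_trans (connect1 _) rv.
    by rewrite /avoid /= duv !inE !negb_or uQ vQ uS vS.
  by split; first exact: connect0.
case/negP: (sepS aA bB ra.2 bS); apply: connect_avoidS ra.1 => //.
exact: subsetUr.
Qed.

Variables (k : nat) (p q : 'I_k -> T * seq T).
Hypotheses (pL : linkage del A (x |: S) p) (qL : linkage del (y |: S) B q).
Hypotheses (xk : #|x |: S| = k) (yk : #|y |: S| = k).

Let last_onto : {in x |: S, forall v, exists i, last (p i).1 (p i).2 = v}.
Proof.
case: pL => pP pD; apply: inj_ord_onto => // [i j E | i]; last by case: (pP i).
by apply: (pD i j (last (p i).1 (p i).2)); rewrite ?mem_last // E mem_last.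
Qed.

Let head_inj i j : (q i).1 = (q j).1 -> i = j.
Proof.
by move=> E; apply: (qL.2 i j (q i).1); rewrite ?mem_head // E mem_head.
Qed.

Let head_onto : {in y |: S, forall v, exists i, (q i).1 = v}.
Proof.
by apply: inj_ord_onto => // i; case: (qL.1 i).
Qed.

(** There are as many paths as vertices in [x |: S], so each of these ends a path; by disjointness
    no path meets the set before its end. *)
Let meet_last i v : v \in x |: S -> v \in (p i).1 :: (p i).2 ->
  v = last (p i).1 (p i).2.
Proof.
move=> vX vi; have [j jE] := last_onto vX.
have -> : i = j by apply: (pL.2 i j v) => //; rewrite -jE mem_last.
by rewrite jE.
Qed.

Let meet_head i v : v \in y |: S -> v \in (q i).1 :: (q i).2 -> v = (q i).1.
Proof.
move=> vX vi; have [j jE] := head_onto vX.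
have -> : i = j by apply: (qL.2 i j v) => //; rewrite -jE mem_head.
by rewrite jE.
Qed.

(** If the paths met outside [S], the start of one followed by the rest of the other would be a
    [del]-walk from [A] to [B] avoiding [S]. *)
Let cross i j v : v \in (p i).1 :: (p i).2 -> v \in (q j).1 :: (q j).2 ->
  [/\ v \in S, v = last (p i).1 (p i).2 & v = (q j).1].
Proof.
move=> vp vq; case: (boolP (v \in S)) => vS.
  by split; [| exact: meet_last (setU1r _ vS) vp | exact: meet_head (setU1r _ vS) vq].
have meet_p u : u \in S -> u \in (p i).1 :: (p i).2 -> u = last (p i).1 (p i).2.
  by move=> uS; apply: meet_last; apply: setU1r.
have meet_q u : u \in S -> u \in (q j).1 :: (q j).2 -> u = (q j).1.
  by move=> uS; apply: meet_head; apply: setU1r.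
have [pp pA _ pu] := pL.1 i; have [qq _ qB qu] := qL.1 j.
move: pp pA pu meet_p vp; case: (p i) => a r /= pp aA pu meet_p vp.
move: qq qB qu meet_q vq; case: (q j) => c r' /= qq bB qu meet_q vq.
case/splitPl: vp pp pu meet_p => r1 r2 r1v; rewrite cat_path r1v.
case/andP => pp _ pu meet_p.
case/splitPl: vq qq qu bB meet_q => r1' r2' r1v'; rewrite cat_path r1v'.
case/andP => _ qq qu bB meet_q; rewrite last_cat r1v' in bB.
have avp : {in a :: r1, forall u, u \notin S}.
  move=> u ur; apply/negP => uS.
  have := meet_p u uS; rewrite -cat_cons mem_cat ur last_cat r1v => /(_ isT).
  case: r2 pu {meet_p} => [|w r2] pu /= uE; first by rewrite -uE uS in vS.
  have : uniq ((a :: r1) ++ w :: r2) by [].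
  rewrite cat_uniq => /and3P [_ /hasPn /(_ u)].
  by rewrite {1}uE mem_last /= ur => /(_ isT).
have avq : {in v :: r2', forall u, u \notin S}.
  move=> u; rewrite inE => /orP [/eqP -> //|ur]; apply/negP => uS.
  have := meet_q u uS; rewrite inE mem_cat ur !orbT => /(_ isT) uE.
  by move: qu; rewrite /= mem_cat -uE ur orbT.
case/negP: (sepS aA bB (avp a (mem_head _ _)) (avq _ (mem_last _ _))).
apply: (@connect_trans _ _ v); apply/connectP.
  by exists r1; rewrite ?r1v // path_avoid.
by exists r2'; rewrite // path_avoid.
Qed.

(* A path of p ending in S continues with the path of q starting there, and the
   path of p ending at x continues with the arc (x, y). *)
Lemma linkage_concat : e x y -> x \notin S -> exists f, linkage e A B (k := k) f.
Proof.
move=> exy xS.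
pose hd i := let v := last (p i).1 (p i).2 in if v == x then y else v.
have /fin_all_exists [s sE] : forall i, exists j, (q j).1 = hd i.
  move=> i; apply: head_onto; rewrite /hd; case: ifP => [_|vx].
    by rewrite setU11.
  by have [_ _] := pL.1 i; rewrite !inE vx => /= -> _; rewrite orbT.
have hd_inj i j : hd i = hd j -> i = j.
  have [_ _ iX _] := pL.1 i; have [_ _ jX _] := pL.1 j.
  (* Otherwise [#|y |: S| = #|S|], whereas [#|x |: S| = #|S| + 1]. *)
  have yS : y \notin S.
    apply/negP => yS; move: yk; rewrite (setUidPr _) ?sub1set // => Sk.
    by move: xk; rewrite cardsU1 xS Sk add1n => /esym /n_Sn.
  have lI : last (p i).1 (p i).2 = last (p j).1 (p j).2 -> i = j.
    by move=> E; apply: (pL.2 i j _ (mem_last _ _)); rewrite E mem_last.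
  move: iX jX lI; rewrite /hd !inE.
  case: eqP => [-> _|_ /= iS]; case: eqP => [-> _|_ /= jS] lI yE.
  - exact: lI.
  - by rewrite yE jS in yS.
  - by rewrite -yE iS in yS.
  - exact: lI.
have s_inj i j : s i = s j -> i = j.
  by move=> E; apply: hd_inj; rewrite -!sE E.
(* After a path ending at [x] the whole path of [q] from [y] is appended; otherwise the common
   vertex must not be listed twice. *)
pose g i := if last (p i).1 (p i).2 == x then (q (s i)).1 :: (q (s i)).2
            else (q (s i)).2.
have gq i v : v \in g i -> v \in (q (s i)).1 :: (q (s i)).2.
  by rewrite /g; case: ifP => // _ vq; rewrite inE vq orbT.
apply: (@shorten_linkage _ _ _ _ _ (fun i => ((p i).1, (p i).2 ++ g i))) => [i | i j v /=].
  have [pp pA _ _] := pL.1 i; have [qq _ qB _] := qL.1 (s i).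
  have [eg lg] : path e (last (p i).1 (p i).2) (g i) /\
      last (last (p i).1 (p i).2) (g i) = last (q (s i)).1 (q (s i)).2.
    have := sE i; rewrite /g /hd; case: eqP => [-> /= sy | _ <-].
      by rewrite {1}sy exy (sub_path del_sub qq).
    by rewrite (sub_path del_sub qq).
  by rewrite /= cat_path last_cat lg (sub_path del_sub pp) eg.
rewrite -!cat_cons !mem_cat => /orP [vi|/gq vi] /orP [vj|/gq vj].
- exact: pL.2 vi vj.
- have [vS vl vh] := cross vi vj; apply: s_inj; apply: head_inj.
  by rewrite sE -vh /hd -vl; case: eqP => // vx; rewrite -vx vS in xS.
- have [vS vl vh] := cross vj vi; apply/esym/s_inj/head_inj.
  by rewrite sE -vh /hd -vl; case: eqP => // vx; rewrite -vx vS in xS.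
- exact/s_inj/(qL.2 _ _ _ vi vj).
Qed.
End ArcDeletion.

(* Induction on the number of arcs: if deleting the arc (x, y) creates a
   separator S with fewer than k vertices, then x |: S and y |: S both have
   exactly k vertices, and A - (x |: S) paths can be glued to
   (y |: S) - B paths. *)
Theorem menger (T : finType) (e : rel T) (A B : {set T}) k :
  (forall S, separates e A B S -> k <= #|S|) ->
  exists f, linkage e A B (k := k) f.
Proof.
have [n] := ubnP #|[set a : T * T | e a.1 a.2]|.
elim: n e A B k => // n IHn e A B k en kS.
have [E0|[[x y]]] := set_0Vmem [set a : T * T | e a.1 a.2].
  (* Without arcs every walk is a single vertex, so [A :&: B] separates and its vertices serve as
     paths. *)
  have /kS kAB : separates e A B (A :&: B).
    move=> a b aA bB aAB bAB; apply/negP => cab.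
    have ab : a = b.
      apply: (connect_ind (a := fun v => a = v)) cab => // u v _ /and3P [euv _ _].
      by have := in_set0 (u, v); rewrite -E0 inE euv.
    by move: aAB; rewrite inE aA ab bB.
  exists (fun i => (enum_val (widen_ord kAB i), [::])); split=> [i | i j v /=].
    by have := enum_valP (widen_ord kAB i); rewrite inE => /andP [? ?]; split.
  rewrite !inE => /eqP -> /eqP /enum_val_inj /(congr1 val) /= ij.
  exact: val_inj.
rewrite inE /= => exy.
pose del : rel T := [rel u v | e u v && ((u, v) != (x, y))].
have del_n : #|[set a : T * T | del a.1 a.2]| < n.
  rewrite -ltnS; apply: leq_trans en; rewrite ltnS; apply: proper_card.
  apply/properP; split; first by apply/subsetP => a; rewrite !inE => /andP [].
  by exists (x, y); rewrite inE /del /= ?exy ?eqxx.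
have [kdel|] := classic (forall S, separates del A B S -> k <= #|S|).
  have [f [fP fD]] := IHn _ _ _ _ del_n kdel; exists f; split=> // i.
  have [? ? ? ?] := fP i; split=> //; apply: sub_path (_ : path del _ _) => //.
  by move=> u v /andP [].
move=> nk; have [S nS] := not_all_ex_not _ _ nk.
have [sepS /negP] := imply_to_and _ _ nS; rewrite -ltnNge => Sk {nk nS}.
have xk := kS _ (separates_tail sepS); have yk := kS _ (separates_head sepS).
have card_eq v : k <= #|v |: S| -> #|v |: S| = k.
  move=> kv; apply/eqP; rewrite eqn_leq kv andbT; apply: leq_trans Sk.
  by rewrite cardsU1; case: (v \notin S).
have xS : x \notin S.
  by apply/negP => xS; move: xk; rewrite (setUidPr _) ?sub1set // leqNgt Sk.
have [p pL] : exists p, linkage del A (x |: S) (k := k) p.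
  by apply: IHn => // Q sQ; apply: kS; apply: separates_from sepS _ sQ.
have [q qL] : exists q, linkage del (y |: S) B (k := k) q.
  by apply: IHn => // Q sQ; apply: kS; apply: separates_to sepS _ sQ.
exact: linkage_concat sepS _ _ _ pL qL (card_eq _ xk) (card_eq _ yk) exy xS.
Qed.

(** With [#|B|] disjoint paths every vertex of [B] ends exactly one, so the paths can be indexed by
    their ends. *)
Corollary menger_onto (T : finType) (e : rel T) (A B : {set T}) :
  (forall S, separates e A B S -> #|B| <= #|S|) ->
  exists (a : T -> T) (p : T -> seq T),
    {in B, forall b, [/\ path e (a b) (p b), a b \in A & last (a b) (p b) = b]} /\
    {in B &, forall b b' v, v \in a b :: p b -> v \in a b' :: p b' -> b = b'}.
Proof.
move=> /menger [f [fP fD]].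
have fI : injective (fun i => last (f i).1 (f i).2).
  move=> i j E; apply: (fD i j (last (f i).1 (f i).2)); first exact: mem_last.
  by rewrite E mem_last.
have fB i : last (f i).1 (f i).2 \in B by case: (fP i).
have onto := inj_ord_onto fI fB erefl.
(* The default [(b, [::])] is never taken for [b] in [B]. *)
pose g b := if [pick i | last (f i).1 (f i).2 == b] is Some i then f i else (b, [::]).
have gP : {in B, forall b, exists2 i, g b = f i & last (f i).1 (f i).2 = b}.
  move=> b /onto [i0 i0b]; rewrite /g; case: pickP => [i /eqP ib|/(_ i0)].
    by exists i.
  by rewrite i0b eqxx.
exists (fun b => (g b).1), (fun b => (g b).2); split=> [b bB | b b' bB b'B v].
  by have [i -> ib] := gP b bB; have [? ? _ _] := fP i.
have [i -> <-] := gP b bB; have [j -> <-] := gP b' b'B.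
by move=> vi vj; rewrite (fD i j v vi vj).
Qed.

(** * Linked models *)

Section Minors.
Variables (V : finType) (H : sgraph V) (W : finType) (G : sgraph W).

Definition adj (v : W) (X : {set W}) : bool := [exists u in X, G v u].

Lemma adjP v (X : {set W}) : reflect (exists2 u, u \in X & G v u) (adj v X).
Proof. exact: exists_inP. Qed.

Lemma adjS v (X Y : {set W}) : X \subset Y -> adj v X -> adj v Y.
Proof. by move=> /subsetP XY /adjP [u /XY uY vu]; apply/adjP; exists u. Qed.

(** A relation on the whole of [W], which spares the subtype of [induced]; [conn_connected]
    translates back. *)
Definition inner (X : {set W}) : rel W := [rel u v | [&& u \in X, v \in X & G u v]].

Definition conn (X : {set W}) : Prop :=
  X != set0 /\ {in X &, forall u v, connect (inner X) u v}.

Lemma conn1 v : conn [set v].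
Proof.
split=> [|a b]; first by apply/set0Pn; exists v; rewrite inE.
by rewrite !inE => /eqP -> /eqP ->.
Qed.

Lemma inner_connect_sym X : connect_sym (inner X).
Proof.
by apply: sym_connect_sym => u v; rewrite /inner /= edge_sym; case: (u \in X); case: (v \in X).
Qed.

Lemma connect_innerS (X Y : {set W}) u v :
  X \subset Y -> connect (inner X) u v -> connect (inner Y) u v.
Proof.
move=> /subsetP XY; apply: connect_sub => a b /and3P [aX bX ab].
by apply: connect1; rewrite /inner /= !XY.
Qed.

Lemma connU X Y u v : conn X -> conn Y -> u \in X -> v \in Y -> G u v ->
  conn (X :|: Y).
Proof.
move=> [X0 cX] [Y0 cY] uX vY uv; set Z := X :|: Y.
have to_u w : w \in Z -> connect (inner Z) w u.
  rewrite inE => /orP [wX|wY].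
    by apply: connect_innerS (cX w u _ _); rewrite ?subsetUl.
  apply: (@connect_trans _ _ v).
    by apply: connect_innerS (cY w v _ _); rewrite ?subsetUr.
  by apply: connect1; rewrite /inner /= !inE uX vY orbT edge_sym.
split=> [|a b aZ bZ]; first by apply/set0Pn; exists u; rewrite inE uX.
by apply: connect_trans (to_u a aZ) _; rewrite inner_connect_sym to_u.
Qed.

Lemma conn_connected X : conn X -> connected (induced G X).
Proof.
move=> [/set0Pn [x0 x0X] cX]; split.
  by apply/card_gt0P; exists (exist _ x0 x0X).
move=> x y; have := cX _ _ (valP x) (valP y).
pose a v := forall vX : v \in X, connect (induced G X) x (exist _ v vX).
have ax : a (val x).
  by move=> vX; rewrite (_ : exist _ _ _ = x) //; apply: val_inj.
move=> cxy; have ay : a (val y).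
  apply: connect_ind ax cxy => u v au /and3P [uX vX uv] vX'.
  by apply: connect_trans (au uX) (connect1 _).
by have := ay (valP y); rewrite (_ : exist _ _ _ = y) //; apply: val_inj.
Qed.

Definition lset (D : {set W}) : {set W + V} :=
  [set n | if n is inl v then v \in D else false].

Definition rset (R : {set V}) : {set W + V} :=
  [set n | if n is inr x then x \in R else false].

Lemma card_rset R : #|rset R| = #|R|.
Proof.
suff -> : rset R = inr @: R by rewrite card_imset // => x y [].
apply/setP => -[v|x]; rewrite inE; first by apply/esym/negbTE/imsetP => -[].
by apply/idP/imsetP => [xR | [y yR [->]]] //; exists x.
Qed.

(* The graph obtained from G[C] by adding every B x with x in R as a single
   vertex inr x; no arc leaves inr x, so that a walk stops as soon as it
   reaches one of these vertices. *)
Definition aux (R : {set V}) (B : V -> {set W}) (C : {set W}) : rel (W + V) :=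
  fun m n => match m, n with
    | inl v, inl u => [&& v \in C, u \in C & G v u]
    | inl v, inr x => [&& v \in C, x \in R & adj v (B x)]
    | _, _ => false
    end.

Definition branch (R : {set V}) (B : V -> {set W}) (C : {set W}) : Prop :=
  [/\ {in R, forall x, conn (B x)},
      {in R &, forall x y, x != y -> [disjoint B x & B y]},
      {in R, forall x, [disjoint B x & C]} &
      {in R &, forall x y, H x y -> exists2 a, a \in B x & adj a (B y)}].

Definition dense (R : {set V}) (B : V -> {set W}) (C : {set W}) : Prop :=
  {in C, forall v, #|V| <= #|[set n | aux R B C (inl v) n]|}.

Definition linked (R : {set V}) (B : V -> {set W}) (C : {set W}) : Prop :=
  forall z (Q : {set W + V}), z \in C -> inl z \notin Q -> #|Q| < #|R| ->
  exists x, [/\ x \in R, inr x \notin Q &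
             connect (avoid (aux R B C) Q) (inl z) (inr x)].

Definition state (R : {set V}) (B : V -> {set W}) (C : {set W}) : Prop :=
  [/\ C != set0, branch R B C, dense R B C & linked R B C].

(** * Absorbing paths into branch sets *)

Definition routed (B : V -> {set W}) x (n : W + V) p : {set W} :=
  B x :|: [set v | inl v \in n :: p].

(** Induction from the end of the path. The second conclusion carries it: it attaches the preceding
    vertex to the part already built. *)
Lemma conn_routed R B C x n p : conn (B x) -> path (aux R B C) n p ->
  last n p = inr x ->
  conn (routed B x n p) /\ forall v, aux R B C (inl v) n -> adj v (routed B x n p).
Proof.
move=> cB; elim: p n => [|m p IHp] n /=.
  move=> _ ->; have -> : routed B x (inr x) [::] = B x.
    by apply/setP => v; rewrite !inE orbF.
  by split=> // v /and3P [].
case/andP=> nm /IHp IH /IH {IH} [cm adjm].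
case: n nm => [u|y]; last by case: m {cm adjm}.
move=> um; have -> : routed B x (inl u) (m :: p) = [set u] :|: routed B x m p.
  by apply/setP => v; rewrite /routed !inE orbCA.
have [w wm uw] := adjP _ _ (adjm u um).
split=> [|v /and3P [_ _ vu]]; first by apply: connU (conn1 u) cm _ wm uw; rewrite inE.
by apply/adjP; exists u; rewrite // !inE eqxx.
Qed.

Lemma route_sub R B C x n p v : path (aux R B C) n p -> last n p = inr x ->
  inl v \in n :: p -> v \in C.
Proof.
elim: p n => [|m p IHp] n /=; first by move=> _ ->; rewrite inE.
case/andP=> nm ep ex; rewrite inE => /orP [/eqP vn|]; last exact: IHp.
by rewrite -vn in nm; case: m nm {ep ex} => [u|y] /and3P [].
Qed.

Lemma route_avoid (e : rel (W + V)) (Q : {set W + V}) n p :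
  path (avoid e Q) n p -> last n p \notin Q -> {in n :: p, forall m, m \notin Q}.
Proof.
elim: p n => [|m p IHp] n /=; first by move=> _ nQ m; rewrite inE => /eqP ->.
case/andP=> /and3P [_ nQ mQ] ep lQ k; rewrite inE => /orP [/eqP -> //|].
exact: IHp.
Qed.

(** [P] contains every exit from [D]. Menger's theorem outside [D] joins [#|R|] nodes of [P] to the
    branch sets by disjoint paths, since a smaller separator would cut off [z]. Each [B x] absorbs
    its path, whose first node is [n x]. *)
Lemma absorb R B C (D : {set W}) (P : {set W + V}) z :
  branch R B C -> linked R B C -> D \subset C -> z \in D ->
  (forall v n, v \in D -> aux R B C (inl v) n -> n \notin lset D -> n \in P) ->
  {in D, forall v, inl v \notin P} ->
  exists (B' : V -> {set W}) (n : V -> W + V),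
    [/\ branch R B' D, {in R, forall x, n x \in P}, {in R &, injective n} &
     {in R, forall x v, aux R B C (inl v) (n x) -> adj v (B' x)}].
Proof.
move=> [cB dB dC eB] lk /subsetP DC zD bdry PD.
have [S sepS|a [p [pP pD]]] :=
    @menger_onto _ (avoid (aux R B C) (lset D)) P (rset R).
  rewrite card_rset leqNgt; apply/negP => SR.
  (* Vertices of [D] in [S] are discarded: the paths avoid [D] anyway, and [linked] needs [z]
     outside the removed set. *)
  have zS : inl z \notin S :\: lset D by rewrite !inE zD.
  have {}SR : #|S :\: lset D| < #|R|.
    exact: leq_ltn_trans (subset_leq_card (subsetDl _ _)) SR.
  have [x [xR xS cx]] := lk z _ (DC z zD) zS SR.
  pose reach m := exists n, [/\ n \in P, n \notin S &
    connect (avoid (avoid (aux R B C) (lset D)) S) n m].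
  (* Each exit of the walk from [D] lands in [P], where a walk avoiding [D] is restarted. *)
  have [//|[n [nP nS cn]]] : inr x \in lset D \/ reach (inr x).
    move: cx; apply: (connect_ind (a := fun m => m \in lset D \/ reach m)).
      move=> m m' am /and3P [mm' mS]; rewrite in_setD negb_and negbK => m'S.
      have [m'D|m'D] := boolP (m' \in lset D); [by left | right].
      rewrite (negbTE m'D) /= in m'S.
      have [mD|mD] := boolP (m \in lset D).
        exists m'; split=> //; case: m mm' mD {am mS} => [v vm'|//].
        by rewrite inE => vD; apply: bdry vm' m'D.
      case: am => [mD'|[n [nP nS cn]]]; first by rewrite mD' in mD.
      exists n; split=> //; apply: connect_trans cn (connect1 _).
      move: mS; rewrite in_setD negb_and negbK (negbTE mD) /= => mS.
      by rewrite /avoid /= mm' mD m'D mS m'S.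
    by left; rewrite inE.
  by rewrite inE.
  have xrS : inr x \notin S by move: xS; rewrite in_setD inE.
  by move: (sepS n (inr x) nP); rewrite inE cn => /(_ xR nS xrS).
pose n x := a (inr x).
have {}pP x : x \in R -> [/\ path (aux R B C) (n x) (p (inr x)), n x \in P,
    last (n x) (p (inr x)) = inr x &
    {in n x :: p (inr x), forall m, m \notin lset D}].
  move=> xR; have [|pp nP lx] := pP (inr x); first by rewrite inE.
  split=> //; first by apply: sub_path pp => u v /and3P [].
  by apply: route_avoid pp _; rewrite lx inE.
have {}pD x y v : x \in R -> y \in R -> v \in n x :: p (inr x) ->
    v \in n y :: p (inr y) -> x = y.
  move=> xR yR vx vy; suff [] : inr x = inr y :> W + V by [].
  by apply: pD vx vy; rewrite inE.
exists (fun x => routed B x (n x) (p (inr x))), n; split.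
- split=> [x xR | x y xR yR xy | x xR | x y xR yR Hxy].
  + by have [pp _ lx _] := pP x xR; case: (conn_routed (cB x xR) pp lx).
  + have [px _ lx _] := pP x xR; have [py _ ly _] := pP y yR.
    rewrite disjoints_subset; apply/subsetP => v.
    rewrite in_setC !in_setU in_set [X in ~~ (_ || X)]in_set.
    have out x' : x' \in R -> v \in B x' -> v \in C -> False.
      by move=> x'R vx' vC; have := disjointFr (dC x' x'R) vx'; rewrite vC.
    case/orP => vx; rewrite negb_or; apply/andP; split.
    * by rewrite (disjointFr (dB x y xR yR xy) vx).
    * by apply/negP => /(route_sub py ly); apply: out vx.
    * by apply/negP => vy; apply: out vy (route_sub px lx vx).
    * by apply: contra xy => vy; rewrite (pD _ _ _ xR yR vx vy).
  + have [_ _ _ av] := pP x xR; rewrite disjoints_subset; apply/subsetP => v.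
    rewrite !in_setU in_setC in_set => /orP [vx|/av]; last by rewrite inE.
    by apply/negP => /DC vC; have := disjointFr (dC x xR) vx; rewrite vC.
  + have [u ux uy] := eB x y xR yR Hxy; exists u; first by rewrite inE ux.
    by apply: adjS uy; apply: subsetUl.
- by move=> x /pP [].
- by move=> x y xR yR nxy; apply: (pD x y (n x)) => //; rewrite ?nxy mem_head.
- move=> x xR; have [pp _ lx _] := pP x xR.
  exact: (conn_routed (cB x xR) pp lx).2.
Qed.

(* phi records how the vertices of one contracted graph become vertices of the
   next one when C shrinks to C' and the other vertices are absorbed into branch
   sets. *)
Record transfers (R : {set V}) (B : V -> {set W}) (C : {set W})
    (R' : {set V}) (B' : V -> {set W}) (C' : {set W}) (phi : W + V -> W + V) : Prop :=
  Transfers {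
    transfer_sub : C' \subset C;
    transfer_id : {in C', forall v, phi (inl v) = inl v};
    transfer_arc : {in C', forall v n,
      aux R B C (inl v) n -> aux R' B' C' (inl v) (phi n)};
    transfer_exit : {in C', forall v n,
      aux R B C (inl v) n -> n \in lset C' \/ exists x, phi n = inr x} }.

(** The walk is followed up to its first exit from [C']: until then [phi] fixes it, and there [phi]
    leads to a branch vertex. *)
Lemma transfer_connect R B C R' B' C' phi (Q Q' : {set W + V}) z n :
  transfers R B C R' B' C' phi ->
  {in C', forall v n, aux R B C (inl v) n -> phi n \in Q' -> n \in Q} ->
  z \in C' -> inl z \notin Q' -> connect (avoid (aux R B C) Q) (inl z) n ->
  n \notin lset C' ->
  exists x, [/\ x \in R', inr x \notin Q' &
             connect (avoid (aux R' B' C') Q') (inl z) (inr x)].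
Proof.
move=> [_ phiE arc exit] QQ' zC' zQ' cn nC'.
set goal := exists x, _.
suff [//|[]] : goal \/ n \in lset C' /\ connect (avoid (aux R' B' C') Q') (inl z) n.
  by rewrite (negbTE nC').
move: cn; apply: (connect_ind (a := fun m => goal \/
  m \in lset C' /\ connect (avoid (aux R' B' C') Q') (inl z) m)); last first.
  by right; rewrite inE.
move=> m m' [|[mC' cm]]; first by left.
case: m mC' cm => [v|//]; rewrite inE => vC' cv /and3P [vm' _ m'Q].
have vQ' := connect_avoid_end zQ' cv; have vphi := arc v vC' _ vm'.
have phiQ' : phi m' \notin Q' by apply: contra m'Q; apply: QQ' vm'.
have {}cv : connect (avoid (aux R' B' C') Q') (inl z) (phi m').
  by apply: connect_trans cv (connect1 _); apply/and3P; split.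
have [m'C'|[x m'x]] := exit v vC' _ vm'.
  right; split=> //; case: m' m'C' cv {vm' m'Q vphi phiQ'} => [u|x]; rewrite inE //.
  by move=> /phiE ->.
left; exists x; rewrite -m'x; split=> //.
by move: vphi; rewrite m'x => /and3P [].
Qed.

(** A would-be separator [Q'] is pulled back to a set [Q] too small to separate in the old graph;
    the walk that escapes [Q] is then transferred. *)
Lemma transfer_linked R B C R' B' C' phi : transfers R B C R' B' C' phi ->
  linked R B C ->
  (forall Q' : {set W + V}, #|Q'| < #|R'| -> exists2 Q : {set W + V}, #|Q| < #|R| &
    {in C', forall v, inl v \in Q -> inl v \in Q'} /\
    {in C', forall v n, aux R B C (inl v) n -> phi n \in Q' -> n \in Q}) ->
  linked R' B' C'.
Proof.
move=> tr lk card z Q' zC' zQ' /card [Q QR [QQ' Q'Q]].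
have zQ : inl z \notin Q by apply: contra zQ'; apply: QQ'.
have zC := subsetP (transfer_sub tr) z zC'.
have [x [_ _ cx]] := lk z Q zC zQ QR.
by apply: transfer_connect tr Q'Q zC' zQ' cx _; rewrite inE.
Qed.

Lemma transfer_dense R B C R' B' C' phi : transfers R B C R' B' C' phi ->
  dense R B C ->
  {in C', forall v, {in [set n | aux R B C (inl v) n] &, injective phi}} ->
  dense R' B' C'.
Proof.
move=> [/subsetP sub _ arc _] dn inj v vC'.
apply: leq_trans (dn v (sub v vC')) _; rewrite -(card_in_imset (inj v vC')).
apply: subset_leq_card; apply/subsetP => _ /imsetP [n + ->].
by rewrite !inE; apply: arc.
Qed.

(** * The moves between states: shrinking, merging, extending *)

(** [absorb] joins [P] to the branch sets and, as [#|P| = #|R|], uses all of [P]. Sending each node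
    of [P] to its branch set then loses no neighbour on the side of [z], and separators pull back
    without growing. *)
Lemma shrink R B C (P : {set W + V}) z : state R B C -> #|P| = #|R| ->
  z \in C -> inl z \notin P ->
  (forall x, x \in R -> ~~ connect (avoid (aux R B C) P) (inl z) (inr x)) ->
  exists B', state R B' [set v in C | connect (avoid (aux R B C) P) (inl z) (inl v)].
Proof.
move=> [_ br dn lk] PR zC zP sepP.
set C' := [set v in C | _].
have zC' : z \in C' by rewrite inE zC connect0.
have C'C : C' \subset C by apply/subsetP => v; rewrite inE => /andP [].
have C'P : {in C', forall v, inl v \notin P}.
  by move=> v; rewrite inE => /andP [_]; apply: connect_avoid_end.
have bdry v n : v \in C' -> aux R B C (inl v) n -> n \notin P ->
    exists2 u, n = inl u & u \in C'.
  move=> vC' vn nP; have vP := C'P v vC'; move: vC'; rewrite inE => /andP [vC cv].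
  have {}cv : connect (avoid (aux R B C) P) (inl z) n.
    by apply: connect_trans cv (connect1 _); apply/and3P; split.
  case: n vn nP cv => [u|x] /and3P [_ uC _] nP cv; last by case/negP: (sepP x uC).
  by exists u; rewrite // inE uC.
have [v n vC' vn|B' [n [br' nP nI nB']]] := absorb br lk C'C zC' _ C'P.
  by apply: contraR => nP; have [u -> uC'] := bdry v n vC' vn nP; rewrite inE.
have imP : n @: R = P.
  apply/eqP; rewrite eqEcard card_in_imset // PR leqnn andbT.
  by apply/subsetP => _ /imsetP [x xR ->]; apply: nP.
(* The inverse of [n] on [P], the identity elsewhere. *)
pose phi m : W + V := if [pick x in R | n x == m] is Some x then inr x else m.
have phiP m : m \in P -> exists2 x, phi m = inr x & x \in R /\ n x = m.
  rewrite -imP => /imsetP [x0 x0R ->]; rewrite /phi.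
  case: pickP => [x /andP [xR /eqP nx]|/(_ x0)]; last by rewrite x0R eqxx.
  by exists x.
have phiN m : m \notin P -> phi m = m.
  rewrite /phi; case: pickP => [x /andP [xR /eqP <-]|//].
  by rewrite (nP x xR).
have tr : transfers R B C R B' C' phi.
  split=> // [v /C'P /phiN //|v vC' m vm|v vC' m vm].
    have [mP|mP] := boolP (m \in P).
      have [x -> [xR nx]] := phiP m mP.
      by rewrite /= vC' xR /=; apply: nB' => //; rewrite nx.
    rewrite phiN //; have [u uE uC'] := bdry v m vC' vm mP.
    by move: vm; rewrite uE /= vC' uC' => /and3P [].
  have [mP|mP] := boolP (m \in P).
    by right; have [x -> _] := phiP m mP; exists x.
  by left; have [u -> uC'] := bdry v m vC' vm mP; rewrite inE.
have phi_inj : {in P :|: lset C' &, injective phi}.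
  have out m : m \in P :|: lset C' -> m \notin P -> exists u, m = inl u.
    rewrite in_setU => /orP [-> //|]; case: m => [u|x]; rewrite inE //.
    by exists u.
  move=> m m' mD m'D; have [mP|mP] := boolP (m \in P); last first.
    have [u uE] := out m mD mP; rewrite (phiN m) //.
    have [m'P|m'P] := boolP (m' \in P); last by rewrite phiN.
    by have [x -> _] := phiP m' m'P; rewrite uE.
  have [x -> [xR <-]] := phiP m mP.
  have [m'P|m'P] := boolP (m' \in P).
    by have [y -> [yR <-]] := phiP m' m'P => -[->].
  by have [u uE] := out m' m'D m'P; rewrite (phiN m') // uE.
have nbrs v m : v \in C' -> aux R B C (inl v) m -> m \in P :|: lset C'.
  move=> vC' vm; rewrite in_setU; have [//|mP] := boolP (m \in P).
  by have [u -> uC'] := bdry v m vC' vm mP; rewrite inE.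
exists B'; split=> //.
- by apply/set0Pn; exists z.
- apply: transfer_dense tr dn _ => v vC' m m'; rewrite !inE => vm vm'.
  by apply: phi_inj; apply: nbrs vC' _.
- apply: transfer_linked tr lk _ => Q' Q'R.
  (* The preimage is cut down to nodes on which [phi] is injective, so it is no larger than [Q']. *)
  exists [set m in P :|: lset C' | phi m \in Q'].
    apply: leq_ltn_trans Q'R; rewrite -(card_in_imset (f := phi)).
      apply: subset_leq_card; apply/subsetP => _ /imsetP [m + ->].
      by rewrite inE => /andP [].
    by move=> m m' /setIdP [? _] /setIdP [? _]; apply: phi_inj.
  split=> [v vC'|v vC' m vm mQ']; first by rewrite inE phiN ?C'P // => /andP [].
  by rewrite inE mQ' (nbrs v).
Qed.

(** [pi] identifies at most [x] and [y]. No vertex of [C] sees both their branch sets, so degrees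
    are kept; the preimage of a separator gains at most one element, which [#|R'| < #|R|] pays
    for. *)
Lemma merge R B C (R' : {set V}) (pi : V -> V) x y :
  state R B C -> #|R'| < #|R| -> x \in R -> y \in R -> H x y ->
  {in C, forall v, ~~ (adj v (B x) && adj v (B y))} ->
  {in R, forall a, pi a \in R'} ->
  {in R', forall r, exists2 a, a \in R & pi a = r} ->
  {in R &, forall a b, pi a = pi b ->
    a = b \/ (a \in [set x; y]) /\ (b \in [set x; y])} ->
  {in R &, forall a b, H (pi a) (pi b) -> exists a' b',
    [/\ a' \in R, b' \in R, pi a' = pi a, pi b' = pi b & H a' b']} ->
  exists B', state R' B' C.
Proof.
move=> [C0 [cB dB dC eB] dn lk] R'R xR yR Hxy nxy piR onto fib Hpi.
pose B' r := \bigcup_(a in R | pi a == r) B a.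
have subB' a : a \in R -> B a \subset B' (pi a).
  by move=> aR; apply: (bigcup_sup a); rewrite aR eqxx.
have B'P v r : v \in B' r -> exists a, [/\ a \in R, pi a = r & v \in B a].
  by case/bigcupP => a /andP [aR /eqP ar] va; exists a.
have tr : transfers R B C R' B' C (fun m => if m is inr a then inr (pi a) else m).
  split=> // [v vC [u|a]|v vC [u|a]] //=.
  - case/and3P=> -> aR va; rewrite piR //=; apply: adjS va; exact: subB'.
  - by case/and3P=> _ uC _; left; rewrite inE.
  - by right; exists (pi a).
exists B'; split=> //; [split | |].
- move=> r /onto [a aR <-].
  have [axy|axy] := boolP (a \in [set x; y]); last first.
    suff -> : B' (pi a) = B a by apply: cB.
    apply/eqP; rewrite eqEsubset subB' // andbT; apply/subsetP => v.
    by case/B'P => b [bR /(fib b a bR aR) [-> //|[_]]]; rewrite (negbTE axy).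
  have [pixy|pixy] := eqVneq (pi x) (pi y).
    have -> : B' (pi a) = B x :|: B y.
      have pia : pi a = pi x by move: axy; rewrite !inE => /orP [] /eqP ->.
      rewrite pia; apply/eqP; rewrite eqEsubset; apply/andP; split.
        apply/subsetP => v /B'P [b [bR bx vb]].
        have [bE|[]] := fib b x bR xR bx; first by rewrite inE -bE vb.
        by rewrite !inE => /orP [] /eqP <- _; rewrite vb ?orbT.
      by rewrite subUset subB' //= pixy subB'.
    have [u ux /adjP [w wy uw]] := eB x y xR yR Hxy.
    exact: connU (cB x xR) (cB y yR) ux wy uw.
  suff -> : B' (pi a) = B a by apply: cB.
  apply/eqP; rewrite eqEsubset subB' // andbT; apply/subsetP => v.
  case/B'P => b [bR ba vb]; have [<- //|[]] := fib b a bR aR ba.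
  move: axy ba; rewrite !inE => /orP [] /eqP ax ba /orP [] /eqP bx _; subst a b => //.
    by rewrite ba eqxx in pixy.
  by rewrite ba eqxx in pixy.
- move=> r r' _ _ rr'; rewrite disjoints_subset; apply/subsetP => v.
  case/B'P => a [aR ar va]; rewrite inE; apply/negP => /B'P [b [bR br vb]].
  have ab : a != b by apply: contra rr' => /eqP ab; rewrite -ar -br ab.
  by rewrite (disjointFr (dB a b aR bR ab) va) in vb.
- move=> r _; rewrite disjoints_subset; apply/subsetP => v.
  by case/B'P => a [aR _ va]; rewrite inE (disjointFr (dC a aR) va).
- move=> r r' /onto [a aR <-] /onto [b bR <-] /(Hpi a b aR bR).
  case=> a' [b' [a'R b'R <- <- /(eB a' b' a'R b'R) [u ua ub]]].
  exists u; first exact: subsetP (subB' a' a'R) u ua.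
  by apply: adjS ub; apply: subB'.
- apply: transfer_dense tr dn _ => v vC [u|a] [u'|b]; rewrite !inE //=.
  case/and3P=> _ aR va /and3P [_ bR vb] [] /(fib a b aR bR) [-> //|[]].
  have := nxy v vC; rewrite !inE => /negP nv.
  by case/orP => /eqP ax; case/orP => /eqP bx; subst a b => //; case: nv; rewrite va vb.
- apply: transfer_linked tr lk _ => Q' Q'R.
  exists [set m | (if m is inr a then (a \in R) && (inr (pi a) \in Q') else m \in Q')].
    (* Without [inr y] the set is mapped injectively into [Q'], so it has at most
       [#|Q'| + 1 <= #|R'|] elements. *)
    set Q := [set m | _]; rewrite (cardsD1 (inr y)).
    apply: leq_ltn_trans R'R; apply: leq_trans Q'R.
    rewrite -add1n; apply: leq_add; first exact: leq_b1.
    pose phi m : W + V := if m is inr a then inr (pi a) else m.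
    rewrite -(card_in_imset (f := phi)).
      apply: subset_leq_card; apply/subsetP => _ /imsetP [m + ->].
      by rewrite !inE => /andP [_]; case: m => // a /andP [].
    move=> [u|a] [u'|b]; rewrite !inE //= => /andP [ay /andP [aR _]].
    case/andP=> b_y /andP [bR _] [] /(fib a b aR bR) [-> //|[]].
    rewrite !inE; move: ay b_y; rewrite !(inj_eq (@inr_inj _ _)).
    by move=> /negbTE -> /negbTE ->; rewrite !orbF => /eqP -> /eqP ->.
  by split=> [v vC|v vC [u|a]]; rewrite !inE //= => /and3P [_ ->].
Qed.
(** Deleting all branch vertices but [inr x] deletes [#|R| - 1] nodes, so a walk still reaches
    [inr x]; its last arc starts at the required vertex. *)
Lemma linked_adj R B C x : linked R B C -> C != set0 -> x \in R ->
  exists2 u, u \in C & adj u (B x).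
Proof.
move=> lk /set0Pn [z zC] xR; pose Q := rset (R :\ x).
have [||y [yR yQ]] := lk z Q zC; first by rewrite inE.
  by rewrite card_rset [ltnRHS](cardsD1 x) xR add1n.
have {yR yQ} -> : y = x.
  by apply/eqP; move: yQ; rewrite !inE yR andbT negbK.
pose a (m : W + V) := m = inr x -> exists2 u, u \in C & adj u (B x).
move=> cx; suff : a (inr x) by apply.
apply: (connect_ind (a := a)) cx => [m m' _ /and3P [mm' _ _] m'x|//].
move: mm'; rewrite m'x; case: m => [u|//] /and3P [uC _ ux].
by exists u.
Qed.

(** [phi] turns [u] into the new branch vertex [inr a]. If linkedness is lost, at most [#|R|] nodes
    cut some [z] off both [u] and the branch sets, and [shrink] applies. *)
Lemma extend R B C a u : state R B C -> #|R| < #|V| -> a \notin R -> u \in C ->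
  {in R, forall x, H a x -> adj u (B x)} ->
  (exists B' C', state (a |: R) B' C' /\ #|C'| < #|C|) \/
  (exists B' C', state R B' C' /\ #|C'| < #|C|).
Proof.
move=> st RV aR uC adjR; have [_ [cB dB dC eB] dn lk] := st.
pose C1 := C :\ u; pose B1 x := if x == a then [set u] else B x.
pose phi m : W + V := if m == inl u then inr a else m.
have xa x : x \in R -> (x == a) = false.
  by move=> xR; apply/eqP => xa; rewrite -xa xR in aR.
have C1P v : v \in C1 -> [/\ v != u, v \in C & phi (inl v) = inl v].
  rewrite !inE => /andP [vu vC]; split=> //.
  by rewrite /phi (inj_eq (@inl_inj _ _)) (negbTE vu).
have tr : transfers R B C (a |: R) B1 C1 phi.
  split=> [|v /C1P [] //|v vC1 m vm|v vC1 m vm]; first exact: subsetDl.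
    rewrite /phi; case: eqP vm => [-> | mu].
      case/and3P=> _ _ vu; rewrite /= vC1 setU11 /B1 eqxx.
      by apply/adjP; exists u; rewrite // inE.
    case: m mu => [w|x] mu /and3P [_ mC vm].
      rewrite /= vC1 vm !inE mC !andbT; apply/eqP => wu.
      by case: mu; rewrite wu.
    by rewrite /= vC1 !inE mC orbT /B1 xa.
  case: m vm => [w|x] /and3P [_ wC _]; last by right; exists x.
  rewrite /phi (inj_eq (@inl_inj _ _)); have [->|wu] := eqVneq w u.
    by right; exists a.
  by left; rewrite !inE wu.
have phi_inj : {in [set m | m != inr a] &, injective phi}.
  move=> m m'; rewrite !inE /phi => ma m'a.
  case: eqP => [->|_]; case: eqP => [->|_] // E; first by rewrite -E eqxx in m'a.
  by rewrite E eqxx in ma.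
(* Otherwise the out-neighbours of [u], at least [#|V|] in number, would all be among the fewer than
   [#|V|] branch vertices. *)
have C10 : C1 != set0.
  apply/negP => /eqP C10; move: RV; rewrite ltnNge => /negP; apply.
  apply: leq_trans (dn u uC) _; rewrite -card_rset; apply: subset_leq_card.
  apply/subsetP => -[w|x]; rewrite !inE => /and3P [_] // wC uw.
  have : w \in C1.
    by rewrite !inE wC andbT; apply/eqP => wu; rewrite wu edge_irrefl in uw.
  by rewrite C10 inE.
have br1 : branch (a |: R) B1 C1.
  rewrite /B1; split=> [x|x y|x|x y]; rewrite !in_setU1.
  - by case: eqP => [_ _|_ /cB //]; apply: conn1.
  - case: eqP => [-> _|_ /= xR]; case: eqP => [-> _|_ /= yR] //.
    + by rewrite eqxx.
    + by rewrite disjoints1 (disjointFl (dC y yR) uC).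
    + by rewrite disjoint_sym disjoints1 (disjointFl (dC x xR) uC).
    + exact: dB.
  - case: eqP => [_ _|_ /dC]; first by rewrite disjoints1 !inE eqxx.
    by apply: disjointWr; apply: subsetDl.
  - case: eqP => [-> _|_ /= xR]; case: eqP => [-> _|_ /= yR].
    + by rewrite edge_irrefl.
    + by move=> /(adjR y yR) uy; exists u; rewrite ?inE.
    + rewrite edge_sym => /(adjR x xR) /adjP [w wx uw]; exists w => //.
      by apply/adjP; exists u; rewrite ?inE // edge_sym.
    + exact: eB.
have C1C : #|C1| < #|C| by rewrite [ltnRHS](cardsD1 u) uC.
have [lk1|] := classic (linked (a |: R) B1 C1).
  left; exists B1, C1; split=> //; split=> //.
  apply: transfer_dense tr dn _ => v _ m m'; rewrite !inE => vm vm'.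
  apply: phi_inj; rewrite inE; apply/eqP => E; [move: vm | move: vm'].
    by rewrite E => /and3P [_ aR']; rewrite aR' in aR.
  by rewrite E => /and3P [_ aR']; rewrite aR' in aR.
move=> /not_all_ex_not [z] /not_all_ex_not [Q] nlk; right.
have [zC1 {}nlk] := imply_to_and _ _ nlk.
have [zQ {}nlk] := imply_to_and _ _ nlk.
have [QR {}nlk] := imply_to_and _ _ nlk.
(* [inr a] is left out because [phi] sends both it and [inl u] to [inr a]. *)
pose P := [set m in [set m | m != inr a] | phi m \in Q].
have sepP m : m \notin lset C1 -> ~~ connect (avoid (aux R B C) P) (inl z) m.
  move=> mC1; apply/negP => cm; apply: nlk.
  apply: transfer_connect tr _ zC1 zQ cm mC1 => v _ n vn nQ.
  apply/setIdP; split=> //; rewrite inE; apply/eqP => E; move: vn; rewrite E.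
  by case/and3P => _ aR'; rewrite aR' in aR.
have [_ zC zphi] := C1P z zC1.
have zP : inl z \notin P by apply: contra zQ => /setIdP []; rewrite zphi.
have PR : #|P| = #|R|.
  apply/eqP; rewrite eqn_leq; apply/andP; split.
    rewrite cardsU1 aR add1n ltnS in QR; apply: leq_trans QR.
    rewrite -(card_in_imset (f := phi)).
      by apply: subset_leq_card; apply/subsetP => _ /imsetP [m /setIdP [_ ?] ->].
    by move=> m m' /setIdP [? _] /setIdP [? _]; apply: phi_inj.
  (* Fewer than [#|R|] nodes cannot cut off [z], because the old state is linked. *)
  rewrite leqNgt; apply/negP => /(lk z P zC zP) [x [_ _ cx]].
  by have := sepP (inr x); rewrite inE cx => /(_ isT).
have [|B' st'] := shrink st PR zC zP.
  by move=> x _; apply: sepP; rewrite inE.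
exists B', [set v in C | connect (avoid (aux R B C) P) (inl z) (inl v)].
split=> //; apply: proper_card; apply/properP; split.
  by apply/subsetP => v; rewrite inE => /andP [].
(* [inl u] lies outside [lset C1], so it is not reached from [z] and the new set is strictly
   smaller. *)
exists u => //; rewrite inE uC /=; apply: sepP.
by rewrite !inE eqxx.
Qed.

(** * From contractions of prefixes to maps of vertices *)

(** [pi] is the quotient map followed by the isomorphism; its properties are those that [merge] asks
    for. *)
Lemma contraction_map (R R' : {set V}) (x y : {x : V | x \in R}) :
  isomorphic (contract (induced H R) x y) (induced H R') ->
  exists pi : V -> V,
  [/\ {in R, forall a, pi a \in R'},
      {in R', forall r, exists2 a, a \in R & pi a = r},
      {in R &, forall a b, pi a = pi b ->
        a = b \/ (a \in [set val x; val y]) /\ (b \in [set val x; val y])} &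
      {in R &, forall a b, H (pi a) (pi b) -> exists a' b',
        [/\ a' \in R, b' \in R, pi a' = pi a, pi b' = pi b & H a' b']}].
Proof.
case=> f [g gK fK] fE.
(* [None] is the value at [x] and [y], and the default outside [R]. *)
pose c a : option {z : {x : V | x \in R} | z \notin [set x; y]} :=
  if insub a is Some a' then insub (a' : {x : V | x \in R}) else None.
have cE z : c (val z) = insub z by rewrite /c valK.
have c0 z : z \in [set x; y] -> c (val z) = None.
  by move=> zxy; rewrite cE insubN // negbK.
exists (fun a => val (f (c a))); split=> [a _|r rR'|a b aR bR|a b aR bR].
- exact: valP.
- case E: (g (exist _ r rR')) => [z|].
    by exists (val (val z)); [exact: valP | rewrite cE valK -E fK].
  by exists (val x); [exact: valP | rewrite c0 ?inE ?eqxx // -E fK].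
- move=> /val_inj /(can_inj gK).
  rewrite -[a]/(val (exist _ a aR)) -[b]/(val (exist _ b bR)) !cE.
  set a' := exist _ a aR; set b' := exist _ b bR.
  case: insubP => [z _ za|]; case: insubP => [z' _ zb|] //.
    by move=> [zz']; left; rewrite -za -zb zz'.
  rewrite !negbK => bxy axy _; right.
  by move: axy bxy; rewrite !inE => /orP [] /eqP -> /orP [] /eqP ->;
    rewrite !eqxx ?orbT.
- have -> : H (val (f (c a))) (val (f (c b))) = contract (induced H R) x y (c a) (c b).
    by rewrite -fE.
  have cR z w : w \in R -> c w = Some z -> val (val z) = w.
    move=> wR; rewrite -[w]/(val (exist _ w wR)) cE.
    by case: insubP => // z' _ <- [->].
  have none z : z \in [set x; y] -> val (f (c (val z))) = val (f None).
    by move=> zxy; rewrite c0.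
  have xE := none x (set21 x y); have yE := none y (set22 x y).
  case ca: (c a) => [z|]; case cb: (c b) => [z'|] //=.
  + by rewrite /induced_edge (cR z a) // (cR z' b) // => ab; exists a, b; rewrite ca cb.
  + rewrite /induced_edge (cR z a) // => /orP [] ab.
      by exists a, (val x); split; rewrite ?ca ?xE //; apply: valP.
    by exists a, (val y); split; rewrite ?ca ?yE //; apply: valP.
  + rewrite /induced_edge (cR z' b) // ![H b _]edge_sym => /orP [] ab.
      by exists (val x), b; split; rewrite ?cb ?xE //; apply: valP.
    by exists (val y), b; split; rewrite ?cb ?yE //; apply: valP.
Qed.

Lemma card_prefix (w : #|V|.-tuple V) s : uniq w -> s <= #|V| -> #|prefix w s| = s.
Proof.
move=> uw sV; rewrite cardsE; have /card_uniqP -> : uniq (take s w) by apply: take_uniq.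
by rewrite size_take_min size_tuple; apply/minn_idPl.
Qed.

Lemma prefixS (w : #|V|.-tuple V) (s : 'I_#|V|) :
  prefix w s.+1 = tnth w s |: prefix w s.
Proof.
apply/setP => x; rewrite !inE (take_nth (tnth w s)) ?size_tuple //.
by rewrite mem_rcons inE -tnth_nth.
Qed.

Lemma tnth_prefix (w : #|V|.-tuple V) (s : 'I_#|V|) :
  uniq w -> tnth w s \notin prefix w s.
Proof.
move=> uw; have := take_uniq s.+1 uw; rewrite (take_nth (tnth w s)) ?size_tuple //.
by rewrite rcons_uniq -tnth_nth inE => /andP [].
Qed.

(** * Growing a model along a contractible ordering *)

Variable Omega : {set #|V|.-tuple V}.
Hypothesis contractible : contractible_ordering H Omega.

(** The ordering is not fixed, since a merge may pass to another member of [Omega]. *)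
Definition reached (s m : nat) : Prop := exists w B C,
  [/\ w \in Omega, state (prefix w s) B C & #|C| = m].

(** The vertex [u] for [extend] depends on the earlier neighbours of the new vertex: with none any
    [u] serves, with one [linked_adj] finds it, and with two the lack of [u] would allow a merge
    with the same [C], which the hypothesis on [s.-1] excludes. *)
Lemma reached_step (s : 'I_#|V|) m : reached s m ->
  (0 < s -> ~ reached s.-1 m) ->
  exists2 m', m' < m & reached s.+1 m' \/ reached s m'.
Proof.
have [_ rec con] := contractible.
move=> [w [B [C [wO st Cm]]]] low; have [uw rw] := rec w wO.
have [C0 br _ lk] := st.
set R := prefix w s in st br lk *; set a := tnth w s.
have aR : a \notin R := tnth_prefix s uw.
have Rs : #|R| = s by apply: card_prefix => //; apply: ltnW.
suff [u uC adjR] : exists2 u, u \in C & {in R, forall x, H a x -> adj u (B x)}.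
  have RV : #|R| < #|V| by rewrite Rs.
  have [] := extend st RV aR uC adjR => -[B' [C' [st' C'C]]].
    exists #|C'|; rewrite -?Cm //; left; exists w, B', C'; split=> //.
    by rewrite prefixS.
  by exists #|C'|; rewrite -?Cm //; right; exists w, B', C'.
have backE x : (x \in back_neighbors H w s) = (x \in R) && H a x.
  by rewrite !inE andbC.
(* [recursive] says nothing at index 0, where there is no earlier vertex. *)
have [s0|s_gt0] := posnP s.
  have [u uC] := set0Pn _ C0; exists u => // x.
  by rewrite (cards0_eq (etrans Rs s0)) inE.
have [back2 backH] := rw s s_gt0.
have [/eqP b2|b2] := boolP (#|back_neighbors H w s| == 2).
  have /cards2P [x [y [xy bE]]] : #|back_neighbors H w s| == 2 by rewrite b2.
  have [xR ax] : x \in R /\ H a x by apply/andP; rewrite -backE bE !inE eqxx.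
  have [yR ay] : y \in R /\ H a y by apply/andP; rewrite -backE bE !inE eqxx orbT.
  have Hxy : H x y by apply: (backH b2); rewrite ?bE ?inE ?eqxx ?orbT.
  have [/exists_inP [u uC /andP [ux uy]]|none] :=
    boolP [exists u in C, adj u (B x) && adj u (B y)].
    exists u => // v vR av; have : v \in [set x; y] by rewrite -bE backE vR.
    by rewrite !inE => /orP [] /eqP ->.
  have [w' w'O iso] := con w wO s s_gt0 (exist _ x xR) (exist _ y yR) xy ax ay.
  have [pi [piR onto fib Hpi]] := contraction_map iso.
  have R'R : #|prefix w' s.-1| < #|R|.
    have [uw' _] := rec w' w'O; rewrite Rs card_prefix // ?prednK //.
    by apply: leq_trans (leq_pred s) (ltnW (ltn_ord s)).
  have [|B' st'] := merge st R'R xR yR Hxy _ piR onto fib Hpi.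
    by move=> v vC; apply: contra none => vxy; apply/exists_inP; exists v.
  by case: (low s_gt0); exists w', B', C.
have [b0|] := posnP #|back_neighbors H w s|.
  have [u uC] := set0Pn _ C0; exists u => // x xR ax.
  by have := backE x; rewrite (cards0_eq b0) inE xR ax.
move=> b_gt0; have /cards1P [x bE] : #|back_neighbors H w s| == 1.
  by rewrite eqn_leq b_gt0 andbT -ltnS ltn_neqAle b2.
have /andP [xR ax] : (x \in R) && H a x by rewrite -backE bE inE.
have [u uC ux] := linked_adj lk C0 xR.
exists u => // y yR ay; have : y \in [set x] by rewrite -bE backE yR.
by rewrite inE => /eqP ->.
Qed.

(** The second conjunct expresses the strict decrease of the least sizes, and is what [reached_step]
    needs at the next stage. *)
Lemma reached_min s : (exists m, reached 0 m) -> s <= #|V| ->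
  exists m, reached s m /\ (0 < s -> forall m', m' <= m -> ~ reached s.-1 m').
Proof.
move=> r0; elim: s => [|s IHs] sV; first by have [m rm] := r0; exists m.
have [m [rm low]] := IHs (ltnW sV).
(* This induction descends to the least [m] for [s]; [reached_step] must then advance to [s.+1],
   with a size below that minimum. *)
have [n] := ubnP m; elim: n m rm low => // n IHn m rm low mn.
have [[m' [m'm rm']]|min] := classic (exists m', m' < m /\ reached s m').
  apply: (IHn m') => // [s0 k km'|]; last exact: leq_trans m'm _.
  by apply: low => //; apply: leq_trans km' (ltnW m'm).
have [|m' m'm [rm'|rm']] := reached_step (s := Ordinal sV) rm.
- by move=> s0; apply: low.
- exists m'; split=> // _ k km' rk; apply: min; exists k; split=> //.
  exact: leq_ltn_trans m'm.
- by case: min; exists m'.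
Qed.

(** All of [G] serves as [C]: without branch sets [linked] is vacuous and [dense] is the degree
    condition. *)
Lemma reached0 : W -> (forall x : W, #|V| <= degree G x) -> exists m, reached 0 m.
Proof.
move=> x0 deg; have [/set0Pn [w wO] _ _] := contractible.
exists #|[set: W]|, w, (fun=> set0), setT; split=> //.
have p0 x : x \in prefix w 0 = false by rewrite inE take0.
split; first by apply/set0Pn; exists x0.
- by split=> [x|x y|x|x y]; rewrite p0.
- move=> v _; apply: leq_trans (deg v) _; rewrite /degree -(card_imset _ (@inl_inj W V)).
  apply: subset_leq_card; apply/subsetP => _ /imsetP [u vu ->].
  by move: vu; rewrite !inE /= !inE.
- by move=> z Q _ _; rewrite (_ : prefix w 0 = set0) ?cards0 //; apply/setP => x; rewrite p0 inE.
Qed.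

(** [absorb] is applied with [[set z]] as [D] and the out-neighbours of [z] as [P]: each path starts
    next to [z], so every enlarged branch set is adjacent to [z]. *)
Lemma cone_minor_of_state B C : state setT B C ->
  exists mu : option V -> {set W},
    is_minor (cone H) G mu /\ exists z : W, mu None = [set z].
Proof.
move=> [/set0Pn [z zC] br dn lk].
pose P := [set m | aux setT B C (inl z) m].
have zz v : v \in [set z] -> inl v \notin P.
  by rewrite !inE => /eqP ->; rewrite /= edge_irrefl !andbF.
have [||B' [n [[cB dB dC eB] nP _ nB]]] := absorb br lk _ (set11 z) _ zz.
- by rewrite sub1set.
- by move=> v m; rewrite !inE => /eqP ->.
have zB x : adj z (B' x).
  by apply: nB; rewrite ?in_setT //; have := nP x (in_setT x); rewrite inE.
exists (fun o => if o is Some x then B' x else [set z]).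
split; last by exists z.
split=> [[x|]|[x|] [y|]|[x|]|[x|] [y|]] //=.
- by have [] := cB x (in_setT x).
- by apply/set0Pn; exists z; rewrite inE.
- by move=> xy; apply: dB; rewrite ?in_setT //; apply: contra xy => /eqP ->.
- by move=> _; apply/dC/in_setT.
- by move=> _; rewrite disjoint_sym; apply/dC/in_setT.
- exact/conn_connected/cB/in_setT.
- exact/conn_connected/conn1.
- by move=> /(eB x y (in_setT x) (in_setT y)) [a ax /adjP [b bY ab]]; exists a, b.
- by move=> _; have [a ax za] := adjP _ _ (zB x); exists a, z; rewrite inE edge_sym.
- by move=> _; have [a ax za] := adjP _ _ (zB y); exists z, a; rewrite inE.
Qed.

End Minors.

Theorem theorem1p4 (V : finType) (H : sgraph V) (hV : 0 < #|V|)
    (hH : exists H' : sgraph V,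
        contractibly_orderable H' /\ spanning_subgraph H H')
    (W : finType) (G : sgraph W) (hW : 0 < #|W|)
    (hdeg : forall x : W, #|{: option V}| - 1 <= degree G x) :
  exists mu : option V -> {set W},
    is_minor (cone H) G mu /\ exists z : W, mu None = [set z].
Proof.
case: hH => H' [[Omega contr] sub].
have deg x : #|V| <= degree G x by rewrite -(addnK 1 #|V|) addn1 -card_option.
have [x0 _] := card_gt0P hW.
have [m [[w [B [C [wO st _]]]] _]] :=
  reached_min contr (reached0 contr x0 deg) (leqnn #|V|).
have [_ rec _] := contr; have [uw _] := rec w wO.
have wT : prefix w #|V| = setT.
  by apply/eqP; rewrite eqEcard subsetT cardsT card_prefix /=.
rewrite wT in st; have [mu [[mu0 muD muC muE] muz]] := cone_minor_of_state st.
(* Edges of [H] are edges of [H'], so the model of [cone H'] also serves [cone H]. *)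
exists mu; split=> //; split=> // x y xy; apply: muE.
by case: x y xy => [x|] [y|] //=; apply: sub.
Qed.
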